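(* Let $\mathcal{X}_f^\mu\subseteq\mathcal{X}$ and $\Sigma_f\succ 0$ be such that, given any $\mu\in\mathcal{X}_f^\mu$ and any covariance matrix $\Sigma\preceq\Sigma_f$, there exists a policy $\rho(\cdot)$ such that, for all $A\in\mathcal{A}$, $B\in\mathcal{B}$, $D\in\mathcal{D}$, $r\in\mathcal{R}$ (with $[A\ B\ D\ r]\in\mathcal{S}$), $$\Pr(\alpha_{x,i}^\top x\le\beta_{x,i})\ge 1-p_{x,i},\quad i=1,\dots,N_x,$$ $$\Pr(\alpha_{u,j}^\top u\le\beta_{u,j})\ge 1-p_{u,j},\quad j=1,\dots,N_u,$$ $$A\mu+B\bar u+r\in\mathcal{X}_f^\mu,$$ $$A\Sigma A^\top+A\Sigma_{xu}B^\top+B\Sigma_{xu}^\top A^\top+B\Sigma_uB^\top+DD^\top\preceq\Sigma_f,$$ where $x\sim\mathcal{N}(\mu,\Sigma)$, $u=\rho(x)$, $\bar u=\mathbb{E}[u\mid\mu,\Sigma]$, $\Sigma_{xu}=\mathbb{E}[(x-\mu)(u-\bar u)^\top\mid\mu,\Sigma]$ and $\Sigma_u=\mathbb{E}[(u-\bar u)(u-\bar u)^\top\mid\mu,\Sigma]$. Then, if Problem (P) is feasible at time $k=0$ using the initialization (I), it remains feasible under the initialization (I) for all future time steps $k>0$.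
   Context: System: $x_{k+1}=A_kx_k+B_ku_k+D_kw_k+r_k$, $k=0,1,\dots$, with fully observed state $x_k\in\mathbb{R}^{n_x}$, control $u_k\in\mathbb{R}^{n_u}$, and i.i.d. disturbances $w_k\sim\mathcal{N}(0,I_{n_w})$ ($w_k$ independent of the past). The parameters satisfy $A_k\in\mathcal{A}$, $B_k\in\mathcal{B}$, $D_k\in\mathcal{D}$, $r_k\in\mathcal{R}$ with $[A_k\ B_k\ D_k\ r_k]\in\mathcal{S}=\mathrm{co}\{S^1,\dots,S^{N_p}\}$ (convex hull), $S^\ell=[A^\ell\ B^\ell\ D^\ell\ r^\ell]$. Constraint data: vectors $\alpha_{x,i},\alpha_{u,j}$, scalars $\beta_{x,i},\beta_{u,j}$, probabilities $p_{x,i},p_{u,j}$ ($i=1,\dots,N_x$, $j=1,\dots,N_u$), $\mathcal{X}=\bigcap_i\{x:\alpha_{x,i}^\top x\le\beta_{x,i}\}$. Stage cost: $\ell_k(x,u)=(x-x_{g_k})^\top Q_k(x-x_{g_k})+u^\top R_ku$ with known bounded $Q_k\succeq0$, $R_k\succ0$ and known targets $x_{g_k}\in\mathcal{X}$. Problem (P) at time $k$, with horizon $N$ and data $(\mu_k,\Sigma_k)$: minimize over sequences of state-feedback policies $\{\rho_{k|k}(\cdot),\dots,\rho_{k+N-1|k}(\cdot)\}$ the cost $\sum_{t=k}^{k+N-1}\mathbb{E}[\ell_t(x_{t|k},u_{t|k})]$ subject to, for $t=k,\dots,k+N-1$: $x_{t+1|k}=A_tx_{t|k}+B_tu_{t|k}+D_tw_t+r_t$;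 $x_{k|k}\sim\mathcal{N}(\mu_k,\Sigma_k)$; $u_{t|k}=\rho_{t|k}(x_{t|k})$; $\Pr(\alpha_{x,i}^\top x_{t|k}\le\beta_{x,i})\ge1-p_{x,i}$ for all $i$; $\Pr(\alpha_{u,j}^\top u_{t|k}\le\beta_{u,j})\ge1-p_{u,j}$ for all $j$; and the terminal constraints $\mathbb{E}[x_{k+N|k}]\in\mathcal{X}_f^\mu$ and $\mathrm{Cov}(x_{k+N|k})\preceq\Sigma_f$. When (P) is feasible at time $k$, $\{\rho^*_{t|k}\}$ denotes an optimal solution (taken to exist), with predicted states $x^*_{t|k}$. Convention: predicted states are Gaussian, $x^*_{t|k}\sim\mathcal{N}(\mu^*_{t|k},\Sigma^*_{t|k})$; that is, all policies considered (including $\rho$ in the claim) are such that the resulting next states are Gaussian. Initialization (I): $(\mu_k,\Sigma_k)=(x_0,0)$ for $k=0$, and $(\mu_k,\Sigma_k)=(\mu^*_{k|k-1},\Sigma^*_{k|k-1})$ for $k>0$, where $\mu^*_{k+1|k}=A_k\mu_k+B_k\bar u_k+r_k$ and $\Sigma^*_{k+1|k}=A_k\Sigma_kA_k^\top+A_k\Sigma_{xu_k}B_k^\top+B_k\Sigma_{xu_k}^\top A_k^\top+B_k\Sigma_{u_k}B_k^\top+D_kD_k^\top$ with $u_k=u^*_{k|k}=\rho^*_{k|k}(x_k)$, $x_k\sim\mathcal{N}(\mu_k,\Sigma_k)$, $\bar u_k=\mathbb{E}[u_k]$, $\Sigma_{xu_k}=\mathbb{E}[(x_k-\mu_k)(u_k-\bar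 u_k)^\top]$, $\Sigma_{u_k}=\mathbb{E}[(u_k-\bar u_k)(u_k-\bar u_k)^\top]$. *)

(* Defs.v *)
From HB Require Import structures.
From mathcomp Require Import all_boot all_order all_algebra.
From mathcomp Require Import all_classical all_reals all_analysis.

Set Implicit Arguments.
Unset Strict Implicit.
Unset Printing Implicit Defensive.

Import Order.TTheory GRing.Theory Num.Theory.
Import numFieldNormedType.Exports.

Local Open Scope classical_set_scope.
Local Open Scope ring_scope.

(* Matrices carry the product sigma-algebra, generated by the entries; over a
   realType this is the Borel sigma-algebra. *)
Definition measure_matrix_display : measure_display -> measure_display.
Proof. exact. Qed.

Section measurable_matrix.
Context {d} {T : measurableType d} (m n : nat).

Definition matrix_cylinders : set (set 'M[T]_(m, n)) :=
  [set C | exists i j,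
     preimage_set_system setT (fun M : 'M[T]_(m, n) => M i j) measurable C].

Let matrix_set0 : <<s matrix_cylinders >> set0.
Proof. exact: sigma_algebra0. Qed.

Let matrix_setC C :
  <<s matrix_cylinders >> C -> <<s matrix_cylinders >> (~` C).
Proof. exact: sigma_algebraC. Qed.

Let matrix_bigcup (F : (set 'M[T]_(m, n))^nat) :
  (forall i, <<s matrix_cylinders >> (F i)) ->
  <<s matrix_cylinders >> (\bigcup_i (F i)).
Proof. exact: sigma_algebra_bigcup. Qed.

HB.instance Definition _ := @isMeasurable.Build (measure_matrix_display d)
  'M[T]_(m, n) <<s matrix_cylinders >> matrix_set0 matrix_setC matrix_bigcup.

End measurable_matrix.

Section matrices.
Context {R : realType}.

Definition dotv n (a x : 'cV[R]_n) : R := (a^T *m x) ord0 ord0.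

Definition quadf n (M : 'M[R]_n) (a : 'cV[R]_n) : R := dotv a (M *m a).

Definition psd n (M : 'M[R]_n) : Prop :=
  M^T = M /\ forall a : 'cV[R]_n, 0 <= quadf M a.

Definition pd n (M : 'M[R]_n) : Prop :=
  M^T = M /\ forall a : 'cV[R]_n, a != 0 -> 0 < quadf M a.

Definition loewner_le n (M M' : 'M[R]_n) : Prop := psd (M' - M).

Definition convex_hull m n (N : nat) (V : 'I_N -> 'M[R]_(m, n)) :
    set 'M[R]_(m, n) :=
  [set M | exists l : 'I_N -> R,
     [/\ forall i, 0 <= l i, \sum_i l i = 1 & M = \sum_i l i *: V i]].

Definition bounded_seq m n (M : nat -> 'M[R]_(m, n)) : Prop :=
  exists c : R, forall k i j, `|M k i j| <= c.

End matrices.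

Section random_vectors.
Context d (Omega : measurableType d) (R : realType) (P : probability Omega R).

(* The library's [normal_prob m s] takes the standard deviation [s] and is not
   the Dirac mass at [m] when [s = 0]. *)
Definition normal_law (m v : R) (B : set R) : \bar R :=
  if v == 0 then \d_m B else normal_prob m (Num.sqrt v) B.

(* X ~ N(mu, S), with S possibly singular: every linear functional of X is
   univariate normal with the corresponding mean and variance. *)
Definition gaussian n (X : Omega -> 'cV[R]_n) (mu : 'cV[R]_n) (S : 'M[R]_n) :
    Prop :=
  psd S /\
  forall (a : 'cV[R]_n) (B : set R), measurable B ->
    P [set om | B (dotv a (X om))] = normal_law (dotv a mu) (quadf S a) B.

Definition is_gaussian n (X : Omega -> 'cV[R]_n) : Prop :=
  exists mu S, gaussian X mu S.

Definition mean n (X : Omega -> 'cV[R]_n) : 'cV[R]_n :=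
  \col_i fine ('E_P[fun om => X om i ord0]).

Definition cross_moment m n (X : Omega -> 'cV[R]_m) (mu : 'cV[R]_m)
    (Y : Omega -> 'cV[R]_n) (nu : 'cV[R]_n) : 'M[R]_(m, n) :=
  \matrix_(i, j)
    fine ('E_P[fun om => (X om - mu) i ord0 * (Y om - nu) j ord0]).

Definition cov n (X : Omega -> 'cV[R]_n) : 'M[R]_n :=
  cross_moment X (mean X) X (mean X).

Definition square_integrable n (X : Omega -> 'cV[R]_n) : Prop :=
  forall i, (fun om => X om i ord0) \in Lfun P 2%:E.

Definition sigma_of n (X : Omega -> 'cV[R]_n) : set (set Omega) :=
  preimage_set_system setT X measurable.

Definition independent_systems (G H : set (set Omega)) : Prop :=
  forall E F, G E -> H F -> P (E `&` F) = (P E * P F)%E.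

Definition noise_events n (w : nat -> Omega -> 'cV[R]_n) (k t : nat) :
    set (set Omega) :=
  \bigcup_(s in [set s | (k <= s < t)%N]) sigma_of (w s).

(* Independence of w_t from (w_0, ..., w_(t-1)) for all t amounts to mutual
   independence of the sequence. *)
Definition iid_standard_normal n (w : nat -> Omega -> 'cV[R]_n) : Prop :=
  forall t, gaussian (w t) 0 1%:M /\
    independent_systems <<s noise_events w 0 t >> (sigma_of (w t)).

Definition noise_independent_of_past m n (w : nat -> Omega -> 'cV[R]_n)
    (k : nat) (x : Omega -> 'cV[R]_m) : Prop :=
  forall t, (k <= t)%N ->
    independent_systems <<s sigma_of x `|` noise_events w k t >>
                        (sigma_of (w t)).

End random_vectors.

Section dynamics.
Context {R : realType} {nx nu nw : nat}.

Definition next_state (A : 'M[R]_nx) (B : 'M[R]_(nx, nu)) (D : 'M[R]_(nx, nw))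
    (r x : 'cV[R]_nx) (u : 'cV[R]_nu) (w : 'cV[R]_nw) : 'cV[R]_nx :=
  A *m x + B *m u + D *m w + r.

Definition next_mean (A : 'M[R]_nx) (B : 'M[R]_(nx, nu)) (r mu : 'cV[R]_nx)
    (ubar : 'cV[R]_nu) : 'cV[R]_nx :=
  A *m mu + B *m ubar + r.

Definition next_cov (A : 'M[R]_nx) (B : 'M[R]_(nx, nu)) (D : 'M[R]_(nx, nw))
    (Sx : 'M[R]_nx) (Sxu : 'M[R]_(nx, nu)) (Su : 'M[R]_nu) : 'M[R]_nx :=
  A *m Sx *m A^T + A *m Sxu *m B^T + B *m Sxu^T *m A^T + B *m Su *m B^T
  + D *m D^T.

Definition sysmx (A : 'M[R]_nx) (B : 'M[R]_(nx, nu)) (D : 'M[R]_(nx, nw))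
    (r : 'cV[R]_nx) : 'M[R]_(nx, nx + nu + nw + 1) :=
  row_mx (row_mx (row_mx A B) D) r.

End dynamics.

(* Np vertices of the parameter polytope, Nx state and Nu input chance
   constraints. *)
Record smpc_data (R : realType) (nx nu nw Np Nx Nu : nat) := SmpcData {
  setA : set 'M[R]_nx;
  setB : set 'M[R]_(nx, nu);
  setD : set 'M[R]_(nx, nw);
  setr : set 'cV[R]_nx;
  vertA : 'I_Np -> 'M[R]_nx;
  vertB : 'I_Np -> 'M[R]_(nx, nu);
  vertD : 'I_Np -> 'M[R]_(nx, nw);
  vertr : 'I_Np -> 'cV[R]_nx;
  sysA : nat -> 'M[R]_nx;
  sysB : nat -> 'M[R]_(nx, nu);
  sysD : nat -> 'M[R]_(nx, nw);
  sysr : nat -> 'cV[R]_nx;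
  alphax : 'I_Nx -> 'cV[R]_nx;
  betax : 'I_Nx -> R;
  probx : 'I_Nx -> R;
  alphau : 'I_Nu -> 'cV[R]_nu;
  betau : 'I_Nu -> R;
  probu : 'I_Nu -> R;
  costQ : nat -> 'M[R]_nx;
  costR : nat -> 'M[R]_nu;
  target : nat -> 'cV[R]_nx;
  horizon : nat;
  termX : set 'cV[R]_nx;
  termS : 'M[R]_nx
}.

Section smpc.
Context d (Omega : measurableType d) (R : realType) (P : probability Omega R).
Context (nx nu nw Np Nx Nu : nat) (p : smpc_data R nx nu nw Np Nx Nu).

Definition admissible (A : 'M[R]_nx) (B : 'M[R]_(nx, nu)) (D : 'M[R]_(nx, nw))
    (r : 'cV[R]_nx) : Prop :=
  [/\ setA p A, setB p B, setD p D, setr p r &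
    convex_hull
      (fun l => sysmx (vertA p l) (vertB p l) (vertD p l) (vertr p l))
      (sysmx A B D r)].

Definition state_set : set 'cV[R]_nx :=
  [set x | forall i, dotv (alphax p i) x <= betax p i].

Definition stage_cost (t : nat) (x : 'cV[R]_nx) (u : 'cV[R]_nu) : R :=
  quadf (costQ p t) (x - target p t) + quadf (costR p t) u.

Definition standing_assumptions : Prop :=
  [/\ (0 < horizon p)%N,
      forall k, admissible (sysA p k) (sysB p k) (sysD p k) (sysr p k),
      (forall i, 0 <= probx p i <= 1) /\ (forall j, 0 <= probu p j <= 1),
      (forall k, psd (costQ p k)) /\ bounded_seq (costQ p) &
      [/\ forall k, pd (costR p k), bounded_seq (costR p) &
          forall k, state_set (target p k)]].

Definition state_chance (x : Omega -> 'cV[R]_nx) : Prop :=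
  forall i, ((1 - probx p i)%:E
    <= P [set om | (dotv (alphax p i) (x om) <= betax p i)%R])%E.

Definition input_chance (u : Omega -> 'cV[R]_nu) : Prop :=
  forall j, ((1 - probu p j)%:E
    <= P [set om | (dotv (alphau p j) (u om) <= betau p j)%R])%E.

Definition terminal_condition (w : nat -> {RV P >-> 'cV[R]_nw}) : Prop :=
  forall (mu : 'cV[R]_nx) (S : 'M[R]_nx),
    termX p mu -> psd S -> loewner_le S (termS p) ->
  exists rho : {mfun 'cV[R]_nx >-> 'cV[R]_nu},
  forall (A : 'M[R]_nx) (B : 'M[R]_(nx, nu)) (D : 'M[R]_(nx, nw))
    (r : 'cV[R]_nx), admissible A B D r ->
  forall x : {RV P >-> 'cV[R]_nx}, gaussian P x mu S ->
  let u := rho \o x in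
  let ubar := mean P u in
  let Sxu := cross_moment P x mu u ubar in
  let Su := cross_moment P u ubar u ubar in
  [/\ state_chance x,
      input_chance u,
      termX p (next_mean A B r mu ubar),
      loewner_le (next_cov A B D S Sxu Su) (termS p) &
      (* the policies considered have finite second moments and keep the next
         state Gaussian *)
      square_integrable P u /\
      forall t, independent_systems P (sigma_of x) (sigma_of (w t)) ->
        is_gaussian P (fun om => next_state A B D r (x om) (u om) (w t om))].

(* Constraints of the problem posed at time k with data (mu, S).  Policies and
   predicted states are indexed by absolute time t; only the values at
   k <= t < k + N (policies) and k <= t <= k + N (states) matter.  The
   predicted state x_{k|k} enters only through its law N(mu, S) and its
   independence from the disturbances w_k, w_(k+1), ... *)
Definition feasible_solution (w : nat -> {RV P >-> 'cV[R]_nw}) (k : nat)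
    (mu : 'cV[R]_nx) (S : 'M[R]_nx)
    (rho : nat -> {mfun 'cV[R]_nx >-> 'cV[R]_nu})
    (x : nat -> {RV P >-> 'cV[R]_nx}) : Prop :=
  let N := horizon p in
  [/\ gaussian P (x k) mu S /\ noise_independent_of_past P w k (x k),
      forall t, (k <= t < k + N)%N -> forall om,
        x t.+1 om = next_state (sysA p t) (sysB p t) (sysD p t) (sysr p t)
                      (x t om) (rho t (x t om)) (w t om),
      forall t, (k <= t < k + N)%N ->
        state_chance (x t) /\ input_chance (rho t \o x t),
      termX p (mean P (x (k + N)%N)) /\
      loewner_le (cov P (x (k + N)%N)) (termS p) &
      forall t, (k <= t < k + N)%N ->
        is_gaussian P (x t.+1) /\ square_integrable P (rho t \o x t)].

Definition feasible (w : nat -> {RV P >-> 'cV[R]_nw}) (k : nat)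
    (mu : 'cV[R]_nx) (S : 'M[R]_nx) : Prop :=
  exists rho x, feasible_solution w k mu S rho x.

Definition cost (k : nat) (rho : nat -> {mfun 'cV[R]_nx >-> 'cV[R]_nu})
    (x : nat -> {RV P >-> 'cV[R]_nx}) : \bar R :=
  (\sum_(k <= t < k + horizon p)
     'E_P[fun om => stage_cost t (x t om) (rho t (x t om))])%E.

Definition optimal_solution (w : nat -> {RV P >-> 'cV[R]_nw}) (k : nat)
    (mu : 'cV[R]_nx) (S : 'M[R]_nx)
    (rho : nat -> {mfun 'cV[R]_nx >-> 'cV[R]_nu})
    (x : nat -> {RV P >-> 'cV[R]_nx}) : Prop :=
  feasible_solution w k mu S rho x /\
  forall rho' x', feasible_solution w k mu S rho' x' ->
    (cost k rho x <= cost k rho' x')%E.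

(* (mu k, S k) are the data of the problem at time k; rho k, x k are the optimal
   policies and predicted states at time k, that is rho k t = rho^*_{t|k} and
   x k t = x^*_{t|k}. *)
Definition mpc_run (w : nat -> {RV P >-> 'cV[R]_nw})
    (x0 : 'cV[R]_nx) (mu : nat -> 'cV[R]_nx) (S : nat -> 'M[R]_nx)
    (rho : nat -> nat -> {mfun 'cV[R]_nx >-> 'cV[R]_nu})
    (x : nat -> nat -> {RV P >-> 'cV[R]_nx}) : Prop :=
  [/\ mu 0%N = x0,
      S 0%N = 0 &
      forall k, feasible w k (mu k) (S k) ->
        optimal_solution w k (mu k) (S k) (rho k) (x k) /\
        let u := rho k k \o x k k in
        let ubar := mean P u in
        let Sxu := cross_moment P (x k k) (mu k) u ubar in
        let Su := cross_moment P u ubar u ubar in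
        mu k.+1 = next_mean (sysA p k) (sysB p k) (sysr p k) (mu k) ubar /\
        S k.+1 = next_cov (sysA p k) (sysB p k) (sysD p k) (S k) Sxu Su].

End smpc.

(* Main.v *)
(* The terminal condition is only invoked at Gaussian states whose mean and
   covariance are known, so the argument has two layers.

   Recursion: from a feasible solution at time k, drop the first policy and append
   the policy that the terminal condition provides for the mean and covariance of
   x_{k+N}.  The chance constraints on k+1, ..., k+N-1 are inherited, those at k+N
   and the new terminal constraints are the conclusions of the terminal condition,
   provided that x_{k+N} is independent of w_{k+N} and that the moments of
   x_{k+N+1} are given by the mean and covariance recursions.

   Moments: the state x_{k+1} is Gaussian by convention, hence N(m, V) with m and V
   its actual mean and covariance (by the first two moments of the normal law and
   polarization of quadratic forms); these are given by the recursions because w_k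
   is centered with unit covariance and independent of (x_k, rho(x_k)). *)

Require Import Defs.
From HB Require Import structures.
From mathcomp Require Import all_boot all_order all_algebra.
From mathcomp Require Import all_classical all_reals all_analysis.
From mathcomp Require Import measurable_realfun ring lra.

Set Implicit Arguments.
Unset Strict Implicit.
Unset Printing Implicit Defensive.

Import Order.TTheory GRing.Theory Num.Theory.
Import numFieldNormedType.Exports.

Local Open Scope classical_set_scope.
Local Open Scope ring_scope.

(** * The first two moments of the normal law *)

Section normal_moments.
Context {R : realType}.
Let mu : {measure set _ -> \bar R} := @lebesgue_measure R.

Let gint (x : R) := \int[mu]_(t in `[0, x]) gauss_fun t.

Let derivable_gint (x : R) : 0 < x -> derivable gint x 1 /\ gint^`()%classic x = gauss_fun x.
Proof.
move=> x0; apply: (@continuous_FTC1_closed R gauss_fun 0 x (x + 1)) => //.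
- by rewrite ltrDl.
- exact/(integrableS _ _ _ integrableT_gauss).
- exact: continuous_gauss_fun.
Qed.

(** Differentiability of [gint] is available only at positive points; this supplies the boundary
    behaviour at 0 for the fundamental theorem on the half-line. *)
Let gint_at0 : gint x @[x --> 0^'+] --> gint 0.
Proof.
have /(continuous_within_itvP _ ltr01)[_ + _] :
    {within `[0, 1], continuous gint}.
  apply: parameterized_integral_continuous => //.
  exact/(integrableS _ _ _ integrableT_gauss).
by [].
Qed.

Let cvg_gint : gint x @[x --> +oo] --> Num.sqrt pi / 2.
Proof.
(* The known limit is that of the squared integral, [pi / 4]; the square root recovers [gint]
   because it is nonnegative. *)
have : Num.sqrt (gint x ^+ 2) @[x --> +oo] --> Num.sqrt (pi / 4 : R).
  apply: (cvg_comp (fun x => gint x ^+ 2) Num.sqrt); last exact: sqrt_continuous.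
  exact: gauss_integral_proof.cvg_integral0_gauss_sqr.
rewrite sqrtrM ?pi_ge0// sqrtrV// (_ : 4 = 2 ^+ 2 :> R) ?sqrtr_sqr; last by ring.
rewrite ger0_norm// (_ : (fun _ => Num.sqrt _) = gint)//; apply/funext => x.
by rewrite sqrtr_sqr ger0_norm// Rintegral_ge0// => t _; exact: gauss_fun_ge0.
Qed.

Let cvg_x_gauss : x * gauss_fun x @[x --> +oo] --> (0 : R).
Proof.
apply: (@squeeze_cvgr _ _ _ _ (cst 0) (fun x => expR (- x))); last 2 first.
- exact: cvg_cst.
- exact: cvgr_expR.
near=> x.
(* From 2 on, [x * (x - 2)] is nonnegative, so [x <= expR x] gives the upper bound
   [expR (x - x ^+ 2) <= expR (- x)]. *)
have x2 : 2 <= x by near: x; exact: nbhs_pinfty_ge.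
have x0 : 0 <= x by lra.
rewrite /= mulr_ge0 ?gauss_fun_ge0//=.
rewrite (@le_trans _ _ (expR x * gauss_fun x))//.
  by rewrite ler_wpM2r ?gauss_fun_ge0// (le_trans _ (expR_ge1Dx _))// lerDr.
rewrite /gauss_fun -expRD ler_expR -subr_ge0.
have -> : - x - (x - x ^+ 2) = x * (x - 2) by ring.
by rewrite mulr_ge0// subr_ge0.
Unshelve. all: by end_near. Qed.

Lemma is_derive_gauss (x : R) :
  is_derive x 1 gauss_fun (- (2 * x) * gauss_fun x).
Proof.
rewrite /gauss_fun; apply: is_derive_eq.
by rewrite /GRing.scale /=; ring.
Qed.

(** By parity the integral is twice the one over the half-line. Integration by parts suggests the
    primitive [F], which vanishes at 0 and tends to [Num.sqrt pi / 4] at infinity. *)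
Lemma integral_sqr_gauss :
  (\int[mu]_x (x ^+ 2 * gauss_fun x)%:E = (Num.sqrt pi / 2)%:E)%E.
Proof.
have cf : continuous (fun x : R => x ^+ 2 * gauss_fun x).
  by move=> x; apply: cvgM; [exact: exprn_continuous|exact: continuous_gauss_fun].
rewrite ge0_symfun_integralT//; last 2 first.
- by move=> x; rewrite mulr_ge0 ?sqr_ge0 ?gauss_fun_ge0.
- by move=> x /=; rewrite /gauss_fun sqrrN.
rewrite -set_itvcy.
(* [F' x = x ^+ 2 * gauss_fun x] *)
pose F (x : R) := 2^-1 * (gint x - x * gauss_fun x).
have dF (x : R) : 0 < x -> is_derive x 1 F (x ^+ 2 * gauss_fun x).
  move=> x0; have [dg g'] := derivable_gint x0.
  have ? : is_derive x 1 gint (gauss_fun x).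
    by rewrite -g' derive1E; exact: derivableP.
  have ? := is_derive_gauss x.
  rewrite /F; apply: is_derive_eq.
  by rewrite /GRing.scale /=; field.
rewrite (@ge0_continuous_FTC2y _ _ F _ (2^-1 * (Num.sqrt pi / 2 - 0))).
- rewrite /F /gint mul0r set_itv1 /Rintegral integral_set1//= !subr0 mulr0 sube0.
  by rewrite -EFinM; congr EFin; field.
- by move=> x _; rewrite mulr_ge0 ?sqr_ge0 ?gauss_fun_ge0.
- exact: continuous_subspaceT.
- apply: cvgM; first exact: cvg_cst.
  by apply: cvgB.
- by move=> x /dF[].
- apply: cvgM; first exact: cvg_cst.
  apply: cvgB => //; apply: cvgM; apply: cvg_at_right_filter.
    exact: cvg_id.
  exact: continuous_gauss_fun.
- by move=> x; rewrite in_itv/= andbT => /dF[? <-]; rewrite derive1E.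
Qed.

(** Split at 0 and reflect the negative half: both sides become sums of the same two half-line
    integrals, in opposite order. *)
Lemma ge0_integral_oppr (f : R -> R) : continuous f -> (forall x, 0 <= f x) ->
  (\int[mu]_x (f x)%:E = \int[mu]_x (f (- x))%:E)%E.
Proof.
have half (g : R -> R) : continuous g -> (forall x, 0 <= g x) ->
    (\int[mu]_x (g x)%:E = \int[mu]_(x in `[0%R, +oo[) (g (- x))%:E +
      \int[mu]_(x in `[0%R, +oo[) (g x)%:E)%E.
  move=> cg g0.
  have mg : measurable_fun setT g by exact: continuous_measurable_fun.
  rewrite -(itv_setU_setT true (0 : R)).
  rewrite ge0_integral_setU//=; last 3 first.
  - exact/measurable_EFinP/measurable_funTS.
  - by move=> x _; rewrite lee_fin.
  - by apply/disj_setPLR => x /=; rewrite !in_itv/= andbT leNgt => ->.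
  rewrite integral_itv_bndo_bndc; last exact/measurable_EFinP/measurable_funTS.
  (* The endpoint 0 is written as [- 0] to fit the substitution by the opposite. *)
  rewrite -{1}oppr0 ge0_integration_by_substitutionNy//.
  exact: continuous_subspaceT.
move=> cf f0; rewrite half// [RHS]half//; last first.
  by move=> x; apply: continuous_comp; [exact: opp_continuous|exact: cf].
by rewrite addeC; congr +%E; apply: eq_integral => x _; rewrite opprK.
Qed.

End normal_moments.

(** * Integrals against the normal law by standardization *)

Section normal_prob_moments.
Context {R : realType}.
Let mu : {measure set _ -> \bar R} := @lebesgue_measure R.
Local Open Scope ereal_scope.

(** The Radon-Nikodym derivative of [normal_prob m s] agrees almost everywhere with the density,
    both having the same integral over every measurable set. *)
Lemma ge0_integral_normal_prob (m s : R) (f : R -> \bar R) :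
    measurable_fun setT f -> (forall x, 0 <= f x) ->
  \int[normal_prob m s]_x f x = \int[mu]_x (f x * (normal_pdf m s x)%:E).
Proof.
move=> mf f0; have dom := normal_prob_dominates m s.
rewrite -(Radon_Nikodym_SigmaFinite.change_of_variables dom)//.
have intf := Radon_Nikodym_SigmaFinite.f_integrable dom.
have mpdf : measurable_fun setT (EFin \o normal_pdf m s).
  by apply/measurable_EFinP; exact: measurable_normal_pdf.
apply: ae_eq_integral => //.
- by apply: emeasurable_funM => //; exact: measurable_int intf.
- exact: emeasurable_funM.
- apply: ae_eqe_mul2l; apply: integral_ae_eq => //= E _ mE.
  by rewrite -Radon_Nikodym_SigmaFinite.f_integral.
Qed.

(** Affine substitution, with scale chosen so that the exponent of the density becomes [- y ^+ 2];
    the Jacobian cancels all of the normalizing constant except [Num.sqrt pi]. *)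
Lemma ge0_integral_normal_prob_gauss (m s : R) (G : R -> R) :
    (0 < s)%R -> continuous G -> (forall x, 0 <= G x)%R ->
  \int[normal_prob m s]_x (G ((x - m) / Num.sqrt (s ^+ 2 *+ 2)))%:E =
  (Num.sqrt pi)^-1%:E * \int[mu]_y (G y * gauss_fun y)%:E.
Proof.
move=> s0 cG G0; set c : R := Num.sqrt (s ^+ 2 *+ 2).
have c0 : (0 < c)%R by rewrite sqrtr_gt0 pmulrn_lgt0// exprn_gt0.
pose F (x : R) : R := ((x - m) / c)%R.
have cF : continuous F.
  move=> x; apply: cvgM; last exact: cvg_cst.
  by apply: cvgB; [exact: cvg_id|exact: cvg_cst].
have dF (x : R) : is_derive x 1%R F (c^-1)%R.
  by rewrite /F; apply: is_derive_eq; rewrite /GRing.scale /=; ring.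
have F'E : F^`()%classic = cst (c^-1)%R.
  by apply/funext => x; rewrite derive1E; have [_ ->] := dF x.
have cGF : continuous (G \o F).
  by move=> x; apply: continuous_comp; [exact: cF|exact: cG].
rewrite ge0_integral_normal_prob//; last first.
- by move=> x; rewrite lee_fin.
- by apply/measurable_EFinP; exact: continuous_measurable_fun cGF.
rewrite (@increasing_ge0_integration_by_substitutionT _ F (G \* gauss_fun)%R).
- rewrite -ge0_integralZl//=; last 2 first.
  + apply/measurable_EFinP; apply: measurable_funM; last by rewrite F'E.
    apply: measurable_funM; first exact: continuous_measurable_fun cGF.
    apply: measurableT_comp; first exact: measurable_gauss_fun.
    exact: continuous_measurable_fun cF.
  + move=> x _; rewrite lee_fin F'E !fctE !mulr_ge0 ?gauss_fun_ge0//.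
    by rewrite invr_ge0 ltW.
  apply: eq_integral => x _; rewrite F'E !fctE -!EFinM; congr EFin.
  rewrite normal_pdfE ?gt_eqF// /normal_peak /normal_fun /gauss_fun /=.
  rewrite (_ : (- F x ^+ 2 = - (x - m) ^+ 2 / (s ^+ 2 *+ 2))%R); last first.
    rewrite /F exprMn exprVn sqr_sqrtr ?mulNr//.
    by rewrite pmulrn_lge0// sqr_ge0.
  (* The factor [c] of the normalizing constant is exactly the inverse of the derivative of [F]. *)
  rewrite (_ : Num.sqrt (s ^+ 2 * pi *+ 2) = c * Num.sqrt pi)%R ?invfM.
    by rewrite -/(F x); ring.
  by rewrite -sqrtrM ?mulrnAl// pmulrn_lge0// sqr_ge0.
- by move=> x y xy; rewrite /F ltr_pM2r ?invr_gt0// ltrD2r.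
- by rewrite F'E => ?; exact: cvg_cst.
- by rewrite F'E; exact: is_cvg_cst.
- by rewrite F'E; exact: is_cvg_cst.
- by move=> x; have [] := dF x.
- by apply/gt0_cvgMlNy; [rewrite invr_gt0|exact: cvg_addrr_Ny].
- by apply/gt0_cvgMly; [rewrite invr_gt0|exact: cvg_addrr].
- by move=> x; apply: cvgM; [exact: cG|exact: continuous_gauss_fun].
- by move=> x; rewrite mulr_ge0 ?gauss_fun_ge0.
Qed.

(** After standardization the integrand is [c ^+ 2 * y ^+ 2] with [c ^+ 2 = s ^+ 2 *+ 2], and the
    Gaussian second moment contributes the compensating factor one half. *)
Lemma integral_normal_prob_sqr (m s : R) : (0 < s)%R ->
  \int[normal_prob m s]_x ((x - m) ^+ 2)%:E = (s ^+ 2)%:E.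
Proof.
move=> s0; set c : R := Num.sqrt (s ^+ 2 *+ 2).
have c2 : (c ^+ 2 = s ^+ 2 *+ 2)%R by rewrite sqr_sqrtr// pmulrn_lge0// sqr_ge0.
have c0 : (c != 0)%R by rewrite gt_eqF// sqrtr_gt0 pmulrn_lgt0// exprn_gt0.
have := @ge0_integral_normal_prob_gauss m s (fun y => c ^+ 2 * y ^+ 2)%R s0.
rewrite -/c => H.
under eq_integral.
  move=> x _; rewrite (_ : ((x - m) ^+ 2 = c ^+ 2 * ((x - m) / c) ^+ 2)%R).
    over.
  by rewrite -exprMn mulrC divfK.
rewrite {}H; last 2 first.
- by move=> x; apply: cvgM; [exact: cvg_cst|exact: exprn_continuous].
- by move=> x; rewrite mulr_ge0 ?sqr_ge0.
under eq_integral do rewrite -mulrA EFinM.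
rewrite ge0_integralZl//; last 3 first.
- apply/measurable_EFinP; apply: measurable_funM; last exact: measurable_gauss_fun.
  exact: measurable_funX.
- by move=> x _; rewrite lee_fin mulr_ge0 ?sqr_ge0 ?gauss_fun_ge0.
- by rewrite lee_fin sqr_ge0.
rewrite integral_sqr_gauss -!EFinM c2; congr EFin.
have : (Num.sqrt pi != 0 :> R)%R by rewrite gt_eqF// sqrtr_gt0 pi_gt0.
by move=> ?; field.
Qed.

(** Expresses that the law is centred at [m] using only nonnegative integrands. Standardization
    reduces the two sides to mirror images, and [gauss_fun] is even. *)
Lemma integral_normal_prob_posneg (m s : R) : (0 < s)%R ->
  \int[normal_prob m s]_x (Num.max (x - m) 0)%:E =
  \int[normal_prob m s]_x (Num.max (- (x - m)) 0)%:E.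
Proof.
move=> s0; set c : R := Num.sqrt (s ^+ 2 *+ 2).
have c0 : (0 < c)%R by rewrite sqrtr_gt0 pmulrn_lgt0// exprn_gt0.
have maxE (y : R) : (Num.max (c * y) 0 = c * Num.max y 0)%R.
  by rewrite -{1}(mulr0 c) -maxr_pMr ?ltW.
have cmax : continuous (fun y : R => Num.max (c * y) 0)%R.
  move=> x; apply: (@continuous_max _ _ (fun y => c * y)%R (cst 0%R)).
    by apply: cvgM; [exact: cvg_cst|exact: cvg_id].
  exact: cvg_cst.
have cmaxN : continuous (fun y : R => Num.max (c * - y) 0)%R.
  move=> x; apply: (@continuous_comp _ _ _ -%R (fun y => Num.max (c * y) 0)%R).
    exact: opp_continuous.
  exact: cmax.
have Gpos := @ge0_integral_normal_prob_gauss m s _ s0 cmax.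
have Gneg := @ge0_integral_normal_prob_gauss m s _ s0 cmaxN.
rewrite -/c in Gpos Gneg.
under eq_integral.
  move=> x _; rewrite (_ : (x - m = c * ((x - m) / c))%R).
    over.
  by rewrite mulrC divfK// gt_eqF.
rewrite Gpos; last by move=> x; rewrite le_max lexx orbT.
under [RHS]eq_integral.
  move=> x _; rewrite (_ : (- (x - m) = c * - ((x - m) / c))%R).
    over.
  by rewrite mulrN mulrC divfK// gt_eqF.
rewrite Gneg; last by move=> x; rewrite le_max lexx orbT.
rewrite [in LHS]ge0_integral_oppr.
- by congr *%E; apply: eq_integral => y _; rewrite /gauss_fun sqrrN.
- by move=> x; apply: cvgM; [exact: cmax|exact: continuous_gauss_fun].
- by move=> x; rewrite mulr_ge0 ?gauss_fun_ge0// le_max lexx orbT.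
Qed.

End normal_prob_moments.

(** * Square-integrable random variables and the moments of [normal_law] *)

Section second_moments.
Context d (Omega : measurableType d) (R : realType) (P : probability Omega R).

Lemma Lfun2_integral_sqr_lty (f : Omega -> R) : measurable_fun setT f ->
  (\int[P]_x (f x ^+ 2)%:E < +oo)%E -> f \in Lfun P 2%:E.
Proof.
move=> mf foo; rewrite inE; apply/andP; split; rewrite inE//=.
rewrite /finite_norm unlock /Lnorm poweR_lty//.
by under eq_integral do rewrite /= powR_mulrn// real_normK ?num_real//.
Qed.

Lemma Lfun2_Lfun1 (f : Omega -> R) : f \in Lfun P 2%:E -> f \in Lfun P 1.
Proof. by apply: Lfun_subset12; exact: fin_num_measure. Qed.

Lemma Lfun2D (f g : Omega -> R) :
  f \in Lfun P 2%:E -> g \in Lfun P 2%:E -> f \+ g \in Lfun P 2%:E.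
Proof. by move=> f2 g2; apply: rpredD; first by rewrite lee1n. Qed.

Lemma normal_law_moments (Y : {RV P >-> R}) (m v : R) : 0 <= v ->
  (forall B, measurable B -> P (Y @^-1` B) = normal_law m v B) ->
  [/\ (Y : Omega -> R) \in Lfun P 2%:E, 'E_P[Y]%E = m%:E &
      'E_P[(fun om => (Y om - m) ^+ 2)%R]%E = v%:E].
Proof.
move=> v0 lawY.
(* Nonnegative functions of [Y] are integrated against its law, which is a Dirac mass in the
   degenerate case [v = 0]. *)
have intY (f : R -> R) : measurable_fun setT f -> (forall y, 0 <= f y) ->
    (\int[P]_om (f (Y om))%:E = if v == 0%R then (f m)%:E
      else \int[normal_prob m (Num.sqrt v)]_y (f y)%:E)%E.
  move=> mf f0; have mf' : measurable_fun setT (EFin \o f) by exact/measurable_EFinP.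
  (* [normal_prob] is a measure on [measurableTypeR R], whose display differs
     from the one [R] carries as the codomain of [Y]. *)
  have mY : measurable_fun setT Y by exact: measurable_funP.
  have {}mY : measurable_fun setT (Y : Omega -> measurableTypeR R) := mY.
  pose Y' : {mfun Omega >-> measurableTypeR R} := @mfun_Sub _ _ _ (measurableTypeR R) Y (mem_set mY).
  rewrite -(@ge0_integral_distribution _ _ _ _ _ P Y' (EFin \o f))//=.
  case: ifPn => v_eq0.
    rewrite (@eq_measure_integral _ _ _ setT (dirac (m : measurableTypeR R))).
      by rewrite integral_dirac// diracT mul1e.
    by move=> A mA _; rewrite /= /distribution /pushforward lawY// /normal_law v_eq0.
  apply: (@eq_measure_integral _ _ _ setT (normal_prob m (Num.sqrt v))) => A mA _.
  by rewrite /= /distribution /pushforward lawY// /normal_law (negbTE v_eq0).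
have mB : measurable_fun setT (fun y : R => y - m) by exact: measurable_funB.
have sqY : (\int[P]_om ((Y om - m) ^+ 2)%:E = v%:E)%E.
  rewrite (intY (fun y => (y - m) ^+ 2)); last 2 first.
  - exact: measurable_funX.
  - by move=> y; exact: sqr_ge0.
  case: ifPn => [/eqP ->|v_neq0]; first by rewrite subrr expr0n.
  by rewrite integral_normal_prob_sqr ?sqr_sqrtr// sqrtr_gt0 lt0r v_neq0.
have posneg : (\int[P]_om (Num.max (Y om - m) 0)%:E =
               \int[P]_om (Num.max (- (Y om - m)) 0)%:E)%E.
  rewrite (intY (fun y => Num.max (y - m) 0)); last 2 first.
  - exact: measurable_maxr.
  - by move=> y; rewrite le_max lexx orbT.
  rewrite (intY (fun y => Num.max (- (y - m)) 0)); last 2 first.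
  - by apply: measurable_maxr => //; exact: measurableT_comp.
  - by move=> y; rewrite le_max lexx orbT.
  case: ifPn => [_|v_neq0]; first by rewrite subrr oppr0.
  by rewrite integral_normal_prob_posneg// sqrtr_gt0 lt0r v_neq0.
have mY : measurable_fun setT (fun om => Y om - m) by exact: measurable_funB.
have Y2 : (fun om => Y om - m) \in Lfun P 2%:E.
  by apply: Lfun2_integral_sqr_lty => //; rewrite sqY ltry.
have Y1 := Lfun2_Lfun1 Y2.
have YE : (Y : Omega -> R) = (fun om => Y om - m) \+ cst m.
  by apply/funext => om /=; rewrite subrK.
split; last by rewrite unlock.
  rewrite YE; apply: Lfun2D => //; exact: Lfun_cst.
rewrite YE expectationD ?Lfun_cst// expectation_cst.
(* The mean of [Y - m] is the difference of the equal integrals of its positive and negative parts;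
   it is 0 because these are finite. *)
rewrite -[X in 'E_P[X]%E]funrposBneg expectationB; last 2 first.
- exact/Lfun1_integrable/integrable_funrpos/Lfun1_integrable.
- exact/Lfun1_integrable/integrable_funrneg/Lfun1_integrable.
rewrite unlock /funrpos /funrneg posneg subee ?add0e//.
rewrite -posneg; apply: integrable_fin_num => //.
exact/integrable_funrpos/Lfun1_integrable.
Qed.

End second_moments.

(** * Expectations of random matrices *)

Section matrix_expectation.
Context d (Omega : measurableType d) (R : realType) (P : probability Omega R).

(** [mean] and [cross_moment] are both instances of this operator, so its linearity serves for both.
    Since [fine] sends infinite values to 0, additivity and the product rules are stated under
    [integrable_mx]. *)
Definition emx m n (M : Omega -> 'M[R]_(m, n)) : 'M[R]_(m, n) :=
  \matrix_(i, j) fine 'E_P[fun om => M om i j].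

Definition integrable_mx m n (M : Omega -> 'M[R]_(m, n)) : Prop :=
  forall i j, (fun om => M om i j) \in Lfun P 1.

Lemma integrable_lincomb (I : Type) (r : seq I) (c : I -> R)
    (f : I -> Omega -> R) : (forall i, f i \in Lfun P 1) ->
  (fun om => \sum_(i <- r) c i * f i om) \in Lfun P 1 /\
  fine 'E_P[fun om => \sum_(i <- r) c i * f i om] =
    \sum_(i <- r) c i * fine 'E_P[f i].
Proof.
move=> fL1; elim: r => [|i r [IHL IHE]].
  under eq_fun do rewrite big_nil.
  by rewrite big_nil expectation_cst; split => //; exact: (@Lfun_cst _ _ _ P 0 1).
under eq_fun do rewrite big_cons.
have cL : c i \o* f i \in Lfun P 1 by exact: Lfun_scale.
have -> : (fun om => c i * f i om + \sum_(j <- r) c j * f j om) =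
    (c i \o* f i) \+ (fun om => \sum_(j <- r) c j * f j om).
  by apply/funext => om /=; rewrite mulrC.
split; first by apply: rpredD.
rewrite expectationD// fineD ?expectation_fin_num// IHE big_cons.
by rewrite expectationZl// fineM ?expectation_fin_num.
Qed.

Lemma integrable_mx_cst m n (A : 'M[R]_(m, n)) : integrable_mx (fun=> A).
Proof. by move=> i j; exact: (@Lfun_cst _ _ _ P (A i j) 1). Qed.

Lemma emx_cst m n (A : 'M[R]_(m, n)) : emx (fun=> A) = A.
Proof. by apply/matrixP => i j; rewrite mxE expectation_cst. Qed.

Lemma integrable_mxD m n (M N : Omega -> 'M[R]_(m, n)) :
  integrable_mx M -> integrable_mx N -> integrable_mx (fun om => M om + N om).
Proof.
move=> iM iN i j; under eq_fun do rewrite mxE.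
by apply: rpredD; [exact: iM|exact: iN].
Qed.

Lemma emxD m n (M N : Omega -> 'M[R]_(m, n)) :
  integrable_mx M -> integrable_mx N ->
  emx (fun om => M om + N om) = emx M + emx N.
Proof.
move=> iM iN; apply/matrixP => i j; rewrite !mxE.
under eq_fun do rewrite mxE.
by rewrite -fineD ?expectation_fin_num// -expectationD.
Qed.

Lemma integrable_mx_mull m n k (A : 'M[R]_(k, m)) (M : Omega -> 'M[R]_(m, n)) :
  integrable_mx M -> integrable_mx (fun om => A *m M om).
Proof.
move=> iM i j; under eq_fun do rewrite mxE.
by have [] := @integrable_lincomb _ (index_enum _) (A i) _ (iM^~ j).
Qed.

Lemma emx_mull m n k (A : 'M[R]_(k, m)) (M : Omega -> 'M[R]_(m, n)) :
  integrable_mx M -> emx (fun om => A *m M om) = A *m emx M.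
Proof.
move=> iM; apply/matrixP => i j; rewrite !mxE.
under eq_fun do rewrite mxE.
have [_ ->] := @integrable_lincomb _ (index_enum _) (A i) _ (iM^~ j).
by apply: eq_bigr => l _; rewrite mxE.
Qed.

Lemma integrable_mx_tr m n (M : Omega -> 'M[R]_(m, n)) :
  integrable_mx M -> integrable_mx (fun om => (M om)^T).
Proof. by move=> iM i j; under eq_fun do rewrite mxE; exact: iM. Qed.

Lemma emx_tr m n (M : Omega -> 'M[R]_(m, n)) :
  emx (fun om => (M om)^T) = (emx M)^T.
Proof.
by apply/matrixP => i j; rewrite !mxE; under eq_fun do rewrite mxE.
Qed.

Lemma integrable_mx_mulr m n k (M : Omega -> 'M[R]_(m, n)) (B : 'M[R]_(n, k)) :
  integrable_mx M -> integrable_mx (fun om => M om *m B).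
Proof.
move=> iM; under eq_fun do rewrite -[_ *m B]trmxK trmx_mul.
exact/integrable_mx_tr/integrable_mx_mull/integrable_mx_tr.
Qed.

Lemma emx_mulr m n k (M : Omega -> 'M[R]_(m, n)) (B : 'M[R]_(n, k)) :
  integrable_mx M -> emx (fun om => M om *m B) = emx M *m B.
Proof.
move=> iM; under eq_fun do rewrite -[_ *m B]trmxK trmx_mul.
rewrite emx_tr emx_mull; last exact: integrable_mx_tr.
by rewrite emx_tr trmx_mul !trmxK.
Qed.

Lemma meanE n (X : Omega -> 'cV[R]_n) : mean P X = emx X.
Proof. by apply/matrixP => i j; rewrite !mxE (fintype.ord1 j). Qed.

Lemma cross_momentE m n (X : Omega -> 'cV[R]_m) mu (Y : Omega -> 'cV[R]_n) nu :
  cross_moment P X mu Y nu = emx (fun om => (X om - mu) *m (Y om - nu)^T).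
Proof.
apply/matrixP => i j; rewrite !mxE; congr (fine (expectation P _)).
by apply/funext => om; rewrite !mxE big_ord1 !mxE.
Qed.

Lemma square_integrable_integrable n (X : Omega -> 'cV[R]_n) :
  square_integrable P X -> integrable_mx X.
Proof. by move=> X2 i j; rewrite ord1; exact/Lfun2_Lfun1. Qed.

Lemma square_integrable_outer m n (X : Omega -> 'cV[R]_m) (Y : Omega -> 'cV[R]_n) :
  square_integrable P X -> square_integrable P Y ->
  integrable_mx (fun om => X om *m (Y om)^T).
Proof.
move=> X2 Y2 i j; under eq_fun do rewrite mxE big_ord1 mxE.
exact: Lfun2_mul_Lfun1 (X2 i) (Y2 j).
Qed.

Lemma square_integrableD n (X Y : Omega -> 'cV[R]_n) :
  square_integrable P X -> square_integrable P Y ->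
  square_integrable P (fun om => X om + Y om).
Proof.
by move=> X2 Y2 i; under eq_fun do rewrite mxE; exact: Lfun2D.
Qed.

Lemma square_integrable_cst n (a : 'cV[R]_n) : square_integrable P (fun=> a).
Proof. by move=> i; exact: Lfun_cst. Qed.

Lemma square_integrableB_cst n (X : Omega -> 'cV[R]_n) (a : 'cV[R]_n) :
  square_integrable P X -> square_integrable P (fun om => X om - a).
Proof.
by move=> X2; apply: square_integrableD => //; exact: square_integrable_cst.
Qed.

End matrix_expectation.

(** * Gaussian vectors *)

Section gaussian_moments.
Context d (Omega : measurableType d) (R : realType) (P : probability Omega R).

Lemma measurable_entry m n (i : 'I_m) (j : 'I_n) :
  measurable_fun setT (fun M : 'M[R]_(m, n) => M i j).
Proof.
move=> _ B mB; rewrite setTI; apply: sub_sigma_algebra.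
by exists i, j, B => //; rewrite setTI.
Qed.

(** Measurability can be tested on the entry cylinders, which generate the sigma-algebra on
    matrices. *)
Lemma measurable_fun_matrix d' (T : measurableType d') m n
    (f : T -> 'M[R]_(m, n)) :
  (forall i j, measurable_fun setT (fun t => f t i j)) -> measurable_fun setT f.
Proof.
move=> mf; apply: (@measurability _ _ _ _ _ _ (@matrix_cylinders _ R m n)) => //.
move=> _ [_ [i [j [B mB <-]]] <-]; rewrite !setTI.
by have := mf i j measurableT B mB; rewrite setTI.
Qed.

Lemma measurable_mulmx d' (T : measurableType d') m n k (A : 'M[R]_(m, n))
    (f : T -> 'M[R]_(n, k)) :
  measurable_fun setT f -> measurable_fun setT (fun t => A *m f t).
Proof.
move=> mf; apply: measurable_fun_matrix => i j.
under eq_fun do rewrite mxE.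
apply: measurable_sum => l; apply: measurable_funM => //.
exact: (measurableT_comp (measurable_entry l j)).
Qed.

Lemma measurable_addmx d' (T : measurableType d') m n (f g : T -> 'M[R]_(m, n)) :
  measurable_fun setT f -> measurable_fun setT g ->
  measurable_fun setT (fun t => f t + g t).
Proof.
move=> mf mg; apply: measurable_fun_matrix => i j.
under eq_fun do rewrite mxE.
by apply: measurable_funD; exact: (measurableT_comp (measurable_entry i j)).
Qed.

Lemma measurable_dotv n (a : 'cV[R]_n) : measurable_fun setT (dotv a).
Proof.
apply: (measurableT_comp (measurable_entry ord0 ord0)).
exact: measurable_mulmx.
Qed.

Lemma dotv_delta n (i : 'I_n) (x : 'cV[R]_n) : dotv (delta_mx i ord0) x = x i ord0.
Proof. by rewrite /dotv trmx_delta -rowE mxE. Qed.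

(** Polarization: evaluating at sums of two basis vectors gives the diagonal entries when the
    vectors coincide, then the off-diagonal ones by symmetry. *)
Lemma quadf_inj n (A B : 'M[R]_n) : A^T = A -> B^T = B ->
  quadf A =1 quadf B -> A = B.
Proof.
have entry (M : 'M[R]_n) i j :
    quadf M (delta_mx i ord0 + delta_mx j ord0) = M i i + M i j + M j i + M j j.
  rewrite /quadf /dotv linearD mulmxDl !mulmxDr !mxE.
  rewrite -!/(dotv _ _).
  have e k l : dotv (delta_mx k ord0) (M *m delta_mx l ord0) = M k l.
    by rewrite dotv_delta -colE mxE.
  by move: (e i i) (e i j) (e j i) (e j j); rewrite /dotv !mxE => -> -> -> ->; ring.
move=> symA symB AB; apply/matrixP => i j.
have := AB (delta_mx i ord0 + delta_mx j ord0); rewrite !entry.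
have := AB (delta_mx i ord0 + delta_mx i ord0); rewrite !entry.
have := AB (delta_mx j ord0 + delta_mx j ord0); rewrite !entry.
have -> : A j i = A i j by rewrite -{1}symA mxE.
have -> : B j i = B i j by rewrite -{1}symB mxE.
by lra.
Qed.

(** Every linear functional of [X] has scalar normal moments. Basis vectors yield integrability and
    the mean; the variances in all directions determine the covariance by polarization. *)
Lemma gaussian_moments n (X : {RV P >-> 'cV[R]_n}) mu S : gaussian P X mu S ->
  [/\ square_integrable P X, mean P X = mu & cov P X = S].
Proof.
move=> [[symS S0] lawX].
have moments (a : 'cV[R]_n) : [/\ (fun om => dotv a (X om)) \in Lfun P 2%:E,
    'E_P[fun om => dotv a (X om)]%E = (dotv a mu)%:E &
    'E_P[(fun om => (dotv a (X om) - dotv a mu) ^+ 2)%R]%E = (quadf S a)%:E].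
  have mY : measurable_fun setT (fun om => dotv a (X om)).
    exact: (measurableT_comp (measurable_dotv a)).
  exact: (@normal_law_moments _ _ _ P (mfun_Sub (mem_set mY)) _ _ (S0 a) (lawX a)).
have X2 : square_integrable P X.
  move=> i; have [+ _ _] := moments (delta_mx i ord0).
  by under eq_fun do rewrite dotv_delta.
have meanX : mean P X = mu.
  apply/matrixP => i j; rewrite mxE (fintype.ord1 j).
  have [_ + _] := moments (delta_mx i ord0).
  by under eq_fun do rewrite dotv_delta; rewrite dotv_delta => ->.
split => //; rewrite /cov meanX.
have X2' := square_integrableB_cst mu X2.
have iXX := square_integrable_outer X2' X2'.
rewrite cross_momentE; apply: quadf_inj => //.
  by rewrite -emx_tr; under eq_fun do rewrite trmx_mul trmxK.
move=> a; have [_ _ /(congr1 fine)/= <-] := moments a.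
rewrite /quadf /dotv -emx_mulr// -emx_mull; last exact: integrable_mx_mulr.
rewrite mxE; congr (fine (expectation P _)); apply/funext => om.
rewrite -mulmxA mulmxA mxE big_ord1 expr2.
have -> : (a^T *m X om) ord0 ord0 - (a^T *m mu) ord0 ord0 =
    (a^T *m (X om - mu)) ord0 ord0 by rewrite mulmxBr !mxE.
by congr *%R; rewrite -[in RHS](trmxK (X om - mu)) -trmx_mul [RHS]mxE.
Qed.

(** Replaces the existential parameters of a Gaussian vector by its actual moments, the form in
    which the terminal constraints mention them. *)
Lemma is_gaussian_gaussian n (X : {RV P >-> 'cV[R]_n}) :
  is_gaussian P X -> gaussian P X (mean P X) (cov P X).
Proof. by move=> [mu [S gX]]; have [_ -> ->] := gaussian_moments gX. Qed.

End gaussian_moments.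

(** * Independence *)

Section independence.
Context d (Omega : measurableType d) (R : realType) (P : probability Omega R).

(** Independence makes the joint law the product of the marginals, and Fubini's theorem then factors
    the integral. *)
Lemma expectation_indepM (U V : {RV P >-> R}) :
    (forall A B, measurable A -> measurable B ->
      (P (U @^-1` A `&` V @^-1` B) = P (U @^-1` A) * P (V @^-1` B))%E) ->
    (U : Omega -> R) \in Lfun P 2%:E -> (V : Omega -> R) \in Lfun P 2%:E ->
  'E_P[(fun om => U om * V om)%R]%E = ('E_P[U] * 'E_P[V])%E.
Proof.
move=> indep U2 V2.
have mW : measurable_fun setT (fun om => (U om, V om)).
  by apply/measurable_fun_pair.
pose W : {RV P >-> (R * R)%type} := mfun_Sub (mem_set mW).
have UV1 : P.-integrable setT (fun om => (U om * V om)%:E).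
  by apply/Lfun1_integrable; exact: Lfun2_mul_Lfun1.
have mM : measurable_fun setT (fun z : R * R => (z.1 * z.2)%:E).
  by apply/measurable_EFinP; exact: measurable_funM.
(* Agreement on rectangles is the independence hypothesis; uniqueness of the product measure extends
   it to all measurable sets. *)
have prodE A : measurable A ->
    (distribution P U \x distribution P V)%E A = distribution P W A.
  apply: product_measure_unique => B C mB mC.
  by rewrite /distribution /pushforward /= -indep//.
have intM : (distribution P U \x distribution P V)%E.-integrable setT
    (fun z : R * R => (z.1 * z.2)%:E).
  apply/integrableP; split=> //.
  rewrite (@eq_measure_integral _ _ _ setT (distribution P W)); last first.
    by move=> A mA _; exact: prodE.
  rewrite ge0_integral_distribution//; last exact: measurableT_comp.
  by move/integrableP : UV1 => [].
have U1 := Lfun2_Lfun1 U2; have V1 := Lfun2_Lfun1 V2.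
have EV (Y : {RV P >-> R}) : (Y : Omega -> R) \in Lfun P 1 ->
    (\int[distribution P Y]_y y%:E = 'E_P[Y])%E /\
    (distribution P Y).-integrable setT (EFin : R -> \bar R).
  move=> Y1; split.
    rewrite integral_distribution//; last exact/Lfun1_integrable.
    by rewrite unlock.
  apply/integrableP; split=> //.
  rewrite ge0_integral_distribution//; last exact: measurableT_comp.
  by move/Lfun1_integrable/integrableP : Y1 => [].
have [EU iU] := EV _ U1; have [EVV iV] := EV _ V1.
transitivity (\int[distribution P W]_z (z.1 * z.2)%:E)%E.
  by rewrite unlock integral_distribution.
transitivity (\int[distribution P U \x distribution P V]_z (z.1 * z.2)%:E)%E.
  by apply: eq_measure_integral => A mA _; exact/esym/prodE.
rewrite -integral12_prod_meas1//=.
transitivity (\int[distribution P U]_x (x%:E * 'E_P[V]))%E.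
  apply: eq_integral => x _ /=; rewrite -EVV -integralZl//.
rewrite -(fineK (expectation_fin_num V1)) integralZr//.
by rewrite EU.
Qed.

Lemma independent_systemsS (G H G' H' : set (set Omega)) :
  G' `<=` G -> H' `<=` H ->
  independent_systems P G H -> independent_systems P G' H'.
Proof. by move=> GG HH indep E F /GG GE /HH HF; exact: indep. Qed.

Lemma sigma_of_comp m n (X : Omega -> 'cV[R]_m) (f : 'cV[R]_m -> 'cV[R]_n) :
  measurable_fun setT f -> sigma_of (f \o X) `<=` sigma_of X.
Proof. exact: preimage_set_system_compS. Qed.

Lemma emx_indep m n (X : {RV P >-> 'cV[R]_m}) (Y : {RV P >-> 'cV[R]_n}) :
    independent_systems P (sigma_of X) (sigma_of Y) ->
    square_integrable P X -> square_integrable P Y ->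
  emx P (fun om => X om *m (Y om)^T) = emx P X *m (emx P Y)^T.
Proof.
move=> indep X2 Y2; apply/matrixP => i j; rewrite !mxE big_ord1 !mxE.
under eq_fun do rewrite mxE big_ord1 mxE.
have mX : measurable_fun setT (fun om => X om i ord0).
  exact: (measurableT_comp (measurable_entry i ord0)).
have mY : measurable_fun setT (fun om => Y om j ord0).
  exact: (measurableT_comp (measurable_entry j ord0)).
rewrite (@expectation_indepM (mfun_Sub (mem_set mX)) (mfun_Sub (mem_set mY))).
- rewrite fineM//; apply: expectation_fin_num.
    exact: Lfun2_Lfun1 (X2 i).
  exact: Lfun2_Lfun1 (Y2 j).
- move=> A B mA mB; apply: indep.
    (* An event about one coordinate is the preimage of a cylinder under the whole vector, hence
       belongs to its sigma-algebra. *)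
    exists ((fun x : 'cV[R]_m => x i ord0) @^-1` A); last by rewrite setTI.
    by have := @measurable_entry R m 1 i ord0 measurableT A mA; rewrite setTI.
  exists ((fun x : 'cV[R]_n => x j ord0) @^-1` B); last by rewrite setTI.
  by have := @measurable_entry R n 1 j ord0 measurableT B mB; rewrite setTI.
- exact: X2.
- exact: Y2.
Qed.

End independence.

(** * Bilinear calculus of second-moment matrices *)

Section second_moment_matrix.
Context d (Omega : measurableType d) (R : realType) (P : probability Omega R).

(** No centring is built in, which keeps this bilinear on square-integrable vectors; on centred
    arguments it is the cross-covariance. *)
Definition outer m n (X : Omega -> 'cV[R]_m) (Y : Omega -> 'cV[R]_n) :=
  emx P (fun om => X om *m (Y om)^T).

Lemma outer_tr m n (X : Omega -> 'cV[R]_m) (Y : Omega -> 'cV[R]_n) :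
  (outer X Y)^T = outer Y X.
Proof. by rewrite -emx_tr; under eq_fun do rewrite trmx_mul trmxK. Qed.

Lemma outerDl m n (X X' : Omega -> 'cV[R]_m) (Y : Omega -> 'cV[R]_n) :
  square_integrable P X -> square_integrable P X' -> square_integrable P Y ->
  outer (fun om => X om + X' om) Y = outer X Y + outer X' Y.
Proof.
move=> X2 X'2 Y2; rewrite /outer; under eq_fun do rewrite mulmxDl.
by rewrite emxD//; exact: square_integrable_outer.
Qed.

Lemma outerDr m n (X : Omega -> 'cV[R]_m) (Y Y' : Omega -> 'cV[R]_n) :
  square_integrable P X -> square_integrable P Y -> square_integrable P Y' ->
  outer X (fun om => Y om + Y' om) = outer X Y + outer X Y'.
Proof.
by move=> X2 Y2 Y'2; rewrite -outer_tr outerDl// linearD /= !outer_tr.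
Qed.

Lemma outer_mull m n k (A : 'M[R]_(k, m)) (X : Omega -> 'cV[R]_m)
    (Y : Omega -> 'cV[R]_n) :
  square_integrable P X -> square_integrable P Y ->
  outer (fun om => A *m X om) Y = A *m outer X Y.
Proof.
move=> X2 Y2; rewrite /outer; under eq_fun do rewrite -mulmxA.
by rewrite emx_mull//; exact: square_integrable_outer.
Qed.

Lemma outer_mulr m n k (B : 'M[R]_(k, n)) (X : Omega -> 'cV[R]_m)
    (Y : Omega -> 'cV[R]_n) :
  square_integrable P X -> square_integrable P Y ->
  outer X (fun om => B *m Y om) = outer X Y *m B^T.
Proof. by move=> X2 Y2; rewrite -outer_tr outer_mull// trmx_mul outer_tr. Qed.

Lemma square_integrable_mull m n (A : 'M[R]_(m, n)) (X : Omega -> 'cV[R]_n) :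
  square_integrable P X -> square_integrable P (fun om => A *m X om).
Proof.
move=> X2 i; under eq_fun do rewrite mxE.
elim: (index_enum _) => [|j r IH].
  by under eq_fun do rewrite big_nil; exact: Lfun_cst.
under eq_fun do rewrite big_cons; apply: Lfun2D => //.
by under eq_fun do rewrite mulrC; apply: Lfun_scale => //; rewrite ler1n.
Qed.

End second_moment_matrix.

(** * One step of the dynamics *)

Section one_step.
Context d (Omega : measurableType d) (R : realType) (P : probability Omega R).
Context (nx nu nw : nat).
Implicit Types (A : 'M[R]_nx) (B : 'M[R]_(nx, nu)) (D : 'M[R]_(nx, nw)).

(** The centred next state is [z + D w], with [z] a function of [x] alone. Independence and [w]
    being centred kill the cross terms, the unit covariance of [w] leaves [D *m D^T], and expanding
    [z] gives the other four terms. *)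
Lemma next_state_moments A B D r (x : {RV P >-> 'cV[R]_nx})
    (rho : {mfun 'cV[R]_nx >-> 'cV[R]_nu}) (w : {RV P >-> 'cV[R]_nw}) mu S :
    gaussian P x mu S -> gaussian P w 0 1%:M ->
    square_integrable P (rho \o x) ->
    independent_systems P (sigma_of x) (sigma_of w) ->
  let u := rho \o x in
  let ubar := mean P u in
  let x' := fun om => next_state A B D r (x om) (u om) (w om) in
  mean P x' = next_mean A B r mu ubar /\
  cov P x' = next_cov A B D S (cross_moment P x mu u ubar)
                              (cross_moment P u ubar u ubar).
Proof.
move=> gx gw u2 indep u ubar x'.
have [x2 meanx covx] := gaussian_moments gx.
have [w2 meanw covw] := gaussian_moments gw.
have ix := square_integrable_integrable x2.
have iu := square_integrable_integrable u2.
have iw := square_integrable_integrable w2.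
have meanx' : mean P x' = next_mean A B r mu ubar.
  rewrite meanE /x' /next_state.
  rewrite emxD ?emx_cst; last exact: integrable_mx_cst; last first.
    apply: integrable_mxD; last exact: integrable_mx_mull.
    by apply: integrable_mxD; exact: integrable_mx_mull.
  rewrite emxD; last exact: integrable_mx_mull; last first.
    by apply: integrable_mxD; exact: integrable_mx_mull.
  rewrite emxD; try exact: integrable_mx_mull.
  by rewrite !emx_mull// -!meanE meanx meanw mulmx0 addr0.
split=> //.
pose xc om := x om - mu; pose uc om := u om - ubar.
have xc2 : square_integrable P xc by exact: square_integrableB_cst.
have uc2 : square_integrable P uc by exact: square_integrableB_cst.
(* State feedback makes the centred noiseless part a measurable function of the state, so it
   inherits the independence of [x] from [w]. *)
pose f (y : 'cV[R]_nx) := A *m (y - mu) + B *m (rho y - ubar).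
have mf : measurable_fun setT f.
  by apply: measurable_addmx; apply: measurable_mulmx; exact: measurable_addmx.
have mz : measurable_fun setT (f \o x) by exact: measurableT_comp.
have [z zE] : exists z : {RV P >-> 'cV[R]_nx},
    (z : Omega -> 'cV[R]_nx) = fun om => A *m xc om + B *m uc om.
  by exists (mfun_Sub (mem_set mz)).
have Ax2 := square_integrable_mull A xc2.
have Bu2 := square_integrable_mull B uc2.
have z2 : square_integrable P z by rewrite zE; exact: square_integrableD.
have Dw2 := square_integrable_mull D w2.
have zw : outer P z w = 0.
  rewrite /outer emx_indep//.
    by rewrite -(meanE P w) meanw trmx0 mulmx0.
  apply: independent_systemsS indep => //; rewrite zE.
  exact: (@sigma_of_comp _ _ _ _ _ x f).
have ww : outer P w w = 1%:M.
  rewrite -covw /cov cross_momentE meanw /outer.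
  by under [in RHS]eq_fun do rewrite subr0.
have -> : cov P x' = outer P (fun om => z om + D *m w om)
                             (fun om => z om + D *m w om).
  rewrite /cov cross_momentE /outer; congr (emx P _).
  apply/funext => om; rewrite meanx' zE.
  suff -> : x' om - next_mean A B r mu ubar =
      A *m xc om + B *m uc om + D *m w om by [].
  rewrite /x' /next_state /next_mean /xc /uc !mulmxBr -/(u om).
  (* The products are generalized so that [mxE] does not expand them into sums before [ring] is
     called. *)
  move: (A *m x om) (B *m u om) (A *m mu) (B *m ubar) (D *m w om) => a b c e g.
  by apply/matrixP => i j; rewrite !mxE; ring.
have D2 := square_integrableD z2 Dw2.
rewrite outerDl// !outerDr// !outer_mull// !outer_mulr// -(outer_tr P z w).
rewrite zw ww trmx0 mul0mx !mulmx0 addr0 add0r mul1mx zE.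
rewrite outerDl//; last exact: square_integrableD.
rewrite !outerDr// !outer_mull// !outer_mulr//.
rewrite /next_cov !cross_momentE -!/(outer P _ _) -/xc -/uc outer_tr.
have -> : S = outer P xc xc by rewrite -covx /cov cross_momentE meanx.
by rewrite !mulmxA !addrA.
Qed.

(** With [Omega] re-equipped with the sigma-algebra generated by [x] and [w], the next state is a
    measurable map. *)
Lemma sigma_of_next_state A B D r (x : Omega -> 'cV[R]_nx)
    (rho : {mfun 'cV[R]_nx >-> 'cV[R]_nu}) (w : Omega -> 'cV[R]_nw) :
  sigma_of (fun om => next_state A B D r (x om) (rho (x om)) (w om)) `<=`
    <<s sigma_of x `|` sigma_of w >>.
Proof.
set G := sigma_of x `|` sigma_of w.
have mx : measurable_fun setT (x : g_sigma_algebraType G -> 'cV[R]_nx).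
  by move=> _ E mE; apply: sub_sigma_algebra; left; exists E.
have mw : measurable_fun setT (w : g_sigma_algebraType G -> 'cV[R]_nw).
  by move=> _ E mE; apply: sub_sigma_algebra; right; exists E.
have mn : measurable_fun setT (fun om : g_sigma_algebraType G =>
    next_state A B D r (x om) (rho (x om)) (w om)).
  apply: measurable_addmx => //; apply: measurable_addmx; last exact: measurable_mulmx.
  apply: measurable_addmx; apply: measurable_mulmx => //.
  exact: measurableT_comp.
by move=> _ [E mE <-]; exact: mn.
Qed.

(** For [t > k], the past seen from [k.+1] up to [t] is contained in the past seen from [k], because
    [w k] already counts among the earlier noises. *)
Lemma noise_independent_of_pastS m n (w : nat -> Omega -> 'cV[R]_nw) k
    (x : Omega -> 'cV[R]_m) (x' : Omega -> 'cV[R]_n) :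
  sigma_of x' `<=` <<s sigma_of x `|` sigma_of (w k) >> ->
  noise_independent_of_past P w k x -> noise_independent_of_past P w k.+1 x'.
Proof.
move=> x'x indep t kt; apply: independent_systemsS (indep t (ltnW kt)) => //.
have sub : <<s sigma_of x `|` sigma_of (w k) >> `<=`
    <<s sigma_of x `|` noise_events w k t >>.
  apply: smallest_sub; first exact: smallest_sigma_algebra.
  move=> F [xF|wF]; apply: sub_sigma_algebra; [by left|right].
  by exists k => //=; rewrite leqnn.
apply: smallest_sub; first exact: smallest_sigma_algebra.
move=> E [/x'x/sub //|[s /= /andP[ks st] sE]].
by apply: sub_sigma_algebra; right; exists s => //=; rewrite (ltnW ks).
Qed.

Lemma noise_independent_of_past_now m (w : nat -> Omega -> 'cV[R]_nw) k
    (x : Omega -> 'cV[R]_m) :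
  noise_independent_of_past P w k x ->
  independent_systems P (sigma_of x) (sigma_of (w k)).
Proof.
move=> /(_ k (leqnn k)); apply: independent_systemsS => // E xE.
by apply: sub_sigma_algebra; left.
Qed.

End one_step.

(** * Recursive feasibility *)

Section receding_horizon.
Context d (Omega : measurableType d) (R : realType) (P : probability Omega R).
Context (nx nu nw Np Nx Nu : nat) (p : smpc_data R nx nu nw Np Nx Nu).
Variable w : nat -> {RV P >-> 'cV[R]_nw}.

(** Gaussianity comes from the initial data at [k] and from the convention on next states
    afterwards; independence propagates along the dynamics by induction on [t]. *)
Lemma feasible_solution_state k mu S rho x t :
    feasible_solution p w k mu S rho x -> (k <= t <= k + horizon p)%N ->
  gaussian P (x t) (mean P (x t)) (cov P (x t)) /\
  noise_independent_of_past P w t (x t).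
Proof.
move=> [[gx indep] dyn _ _ reg] /andP[kt tN]; split.
  move: kt; rewrite leq_eqVlt => /predU1P[<-|].
    by apply: is_gaussian_gaussian; exists mu, S.
  case: t tN => [_ k0|t tN]; first by exfalso; rewrite ltn0 in k0.
  rewrite ltnS => kt; apply: is_gaussian_gaussian.
  have ktN : (k <= t < k + horizon p)%N by rewrite kt.
  exact: (reg t ktN).1.
elim: t kt tN => [|t IH].
  by rewrite leqn0 => /eqP k0 _; rewrite k0 in indep.
rewrite leq_eqVlt => /predU1P[<- _|kt tN]; first exact: indep.
apply: noise_independent_of_pastS (IH kt (ltnW tN)).
rewrite (_ : (x t.+1 : Omega -> _) = fun om => next_state (sysA p t) (sysB p t)
  (sysD p t) (sysr p t) (x t om) (rho t (x t om)) (w t om)).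
  exact: sigma_of_next_state.
by apply/funext => om; rewrite dyn// tN andbT.
Qed.

(** The new data are the moments of the old predicted state [x k.+1], so the old trajectory can be
    continued instead of being rebuilt from a fresh initial state. *)
Lemma feasible_solution_shift k mu S rho x :
    standing_assumptions p -> iid_standard_normal P w -> terminal_condition p w ->
    feasible_solution p w k mu S rho x ->
  let u := rho k \o x k in
  let ubar := mean P u in
  feasible p w k.+1 (next_mean (sysA p k) (sysB p k) (sysr p k) mu ubar)
    (next_cov (sysA p k) (sysB p k) (sysD p k) S
      (cross_moment P (x k) mu u ubar) (cross_moment P u ubar u ubar)).
Proof.
move=> [N0 adm _ _ _] iid hterm sol u ubar.
have state t := @feasible_solution_state k mu S rho x t sol.
have [[gx indepk] dyn chance [termX_mean termS_cov] reg] := sol.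
set T := (k + horizon p)%N.
(* A positive horizon ensures that [x k.+1] is still a state of the old solution. *)
have kT : (k < T)%N by rewrite -[ltnLHS]addn0 ltn_add2l.
have [gT indepT] : gaussian P (x T) (mean P (x T)) (cov P (x T)) /\
    noise_independent_of_past P w T (x T).
  by apply: state; rewrite (ltnW kT) leqnn.
(* The terminal policy depends only on the mean and covariance of [x T]; the system matrices at time
   [T] are supplied afterwards. *)
have [rhoT hrhoT] := hterm _ _ termX_mean gT.1 termS_cov.
have [chancexT chanceuT termXT termST [uT2 gaussT]] := hrhoT _ _ _ _ (adm T) _ gT.
have nowT := noise_independent_of_past_now indepT.
have [xN xNE] : exists xN : {RV P >-> 'cV[R]_nx},
    (xN : Omega -> _) = fun om => next_state (sysA p T) (sysB p T) (sysD p T)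
      (sysr p T) (x T om) (rhoT (x T om)) (w T om).
  have mN : measurable_fun setT (fun om => next_state (sysA p T) (sysB p T)
      (sysD p T) (sysr p T) (x T om) (rhoT (x T om)) (w T om)).
    apply: measurable_addmx => //; apply: measurable_addmx; last exact: measurable_mulmx.
    apply: measurable_addmx; apply: measurable_mulmx => //.
    exact: measurableT_comp.
  by exists (mfun_Sub (mem_set mN)).
(* Indexing by absolute time means no shift: only the state at [T.+1] and the policy at [T] are
   replaced. *)
pose x' t := if t == T.+1 then xN else x t.
pose rho' t := if t == T then rhoT else rho t.
have x'E t : (t <= T)%N -> x' t = x t.
  by move=> tT; rewrite /x' ltn_eqF.
have x'T : x' T.+1 = xN by rewrite /x' eqxx.
have rho'E t : (t < T)%N -> rho' t = rho t.
  by move=> tT; rewrite /rho' ltn_eqF.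
have rho'T : rho' T = rhoT by rewrite /rho' eqxx.
have steps t : (k.+1 <= t < k.+1 + horizon p)%N ->
    t = T \/ (t < T)%N /\ (k <= t < k + horizon p)%N.
  move=> /andP[kt]; rewrite addSn ltnS leq_eqVlt => /predU1P[->|tT]; [by left|right].
  by rewrite tT (ltnW kt).
exists rho', x'; split.
- rewrite (x'E _ kT).
  have [gk1 indepk1] : gaussian P (x k.+1) (mean P (x k.+1)) (cov P (x k.+1)) /\
      noise_independent_of_past P w k.+1 (x k.+1).
    by apply: state; rewrite leqnSn kT.
  split; last exact: indepk1.
  have ku : (k <= k < k + horizon p)%N by rewrite leqnn.
  have [_ u2] := reg k ku.
  have nowk := noise_independent_of_past_now indepk.
  have [] := next_state_moments (sysA p k) (sysB p k) (sysD p k) (sysr p k)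
    gx (iid k).1 u2 nowk.
  have <- : (x k.+1 : Omega -> _) = fun om => next_state (sysA p k) (sysB p k)
      (sysD p k) (sysr p k) (x k om) ((rho k \o x k) om) (w k om).
    by apply/funext => om; exact: dyn.
  (* Read backwards, the moment recursions turn the prescribed data into the mean and covariance of
     [x k.+1]. *)
  by move=> <- <-; exact: gk1.
- move=> t /steps[->|[tT kt]] om.
    by rewrite x'T rho'T (x'E _ (leqnn T)) xNE.
  by rewrite (x'E _ tT) (x'E _ (ltnW tT)) (rho'E _ tT); exact: dyn.
- move=> t /steps[->|[tT kt]].
    by rewrite rho'T (x'E _ (leqnn T)); split; [exact: chancexT|exact: chanceuT].
  by rewrite (x'E _ (ltnW tT)) (rho'E _ tT); exact: chance.
(* The new horizon ends at [k.+1 + horizon p], that is [T.+1], where the state is the appended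
   one. *)
- rewrite addSn x'T xNE.
  have [-> ->] := next_state_moments (sysA p T) (sysB p T) (sysD p T) (sysr p T)
    gT (iid T).1 uT2 nowT.
  by split; [exact: termXT|exact: termST].
- move=> t /steps[->|[tT kt]].
    rewrite x'T rho'T (x'E _ (leqnn T)) xNE.
    by split; [exact: gaussT|exact: uT2].
  by rewrite (x'E _ tT) (x'E _ (ltnW tT)) (rho'E _ tT); exact: reg.
Qed.

End receding_horizon.

Theorem theorem1 (R : realType) (d : measure_display)
    (Omega : measurableType d) (P : probability Omega R)
    (nx nu nw Np Nx Nu : nat) (p : smpc_data R nx nu nw Np Nx Nu)
    (w : nat -> {RV P >-> 'cV[R]_nw}) (x0 : 'cV[R]_nx)
    (mu : nat -> 'cV[R]_nx) (S : nat -> 'M[R]_nx)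
    (rho : nat -> nat -> {mfun 'cV[R]_nx >-> 'cV[R]_nu})
    (x : nat -> nat -> {RV P >-> 'cV[R]_nx})
    (hp : standing_assumptions p)
    (hw : iid_standard_normal P w)
    (hX : termX p `<=` state_set p)
    (hS : pd (termS p))
    (hterm : terminal_condition p w)
    (hrun : mpc_run p w x0 mu S rho x) :
  feasible p w 0 (mu 0%N) (S 0%N) ->
  forall k, (0 < k)%N -> feasible p w k (mu k) (S k).
Proof.
move=> feas0; have [mu0 S0 step] := hrun.
elim=> // k IH _.
(* The induction hypothesis covers positive times only; at time 0 the assumed feasibility takes its
   place. *)
have feask : feasible p w k (mu k) (S k) by case: k IH => // k; apply.
(* Feasibility at [k] makes the optimal solution available, and the data at [k.+1] are by definition
   its moment recursions. *)
have [[sol _] [-> ->]] := step k feask.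
exact: feasible_solution_shift.
Qed.
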